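(* Let $N\ge1$ and let $\pi,\sigma\in S_{N+1}$ be distinct. There is a transition in the PT chain on $S_{N+1}$ from $\pi$ to $\sigma$ if and only if there is a transition from $\overline\pi$ to $\overline\sigma$. Furthermore, regarding the transition probabilities as formal expressions in the indeterminates $\alpha,\beta,q$: (1) $\mathrm{prob}(\pi\to\sigma)=\frac{\alpha}{N+1}$ if and only if $\mathrm{prob}(\overline\pi\to\overline\sigma)=\frac{\beta}{N+1}$; (2) $\mathrm{prob}(\pi\to\sigma)=\frac{\beta}{N+1}$ if and only if $\mathrm{prob}(\overline\pi\to\overline\sigma)=\frac{\alpha}{N+1}$; (3) $\mathrm{prob}(\pi\to\sigma)=\frac{1}{N+1}$ if and only if $\mathrm{prob}(\overline\pi\to\overline\sigma)=\frac{1}{N+1}$; (4) $\mathrm{prob}(\pi\to\sigma)=\frac{q}{N+1}$ if and only if $\mathrm{prob}(\overline\pi\to\overline\sigma)=\frac{q}{N+1}$.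
   Context: For $\pi\in S_{N+1}$, $\overline\pi\in S_{N+1}$ is defined by $\overline{\pi}(1)=N+2-\pi(1)$ and $\overline{\pi}(i)=N+2-\pi(N+3-i)$ for $2\le i\le N+1$. A weak excedance of $\pi$ is an index $i$ with $\pi(i)\ge i$; a non-excedance is an index $i$ with $\pi(i)<i$. If $\pi$ is a permutation of a finite set $S$ of reals and $i\in S$ with $\pi(i)\ne i$, the collapse of $\pi$ at $i$ is the permutation $\sigma$ of $S\setminus\{i\}$ with $\sigma(\pi^{-1}(i))=\pi(i)$ and $\sigma(j)=\pi(j)$ for $j\ne\pi^{-1}(i)$. If $\pi$ is a permutation of $S=\{s_1<\dots<s_n\}$, its normalization $\mathrm{Norm}(\pi)$ is the permutation of $\{1,\dots,n\}$ obtained by replacing each $s_i$ by $i$. The PT chain on $S_{N+1}$ has exactly the following transitions between distinct states, from $\pi\in S_{N+1}$ (with the remaining probability the chain stays at $\pi$; ''transition'' means one of the moves below). (a) Particle enters from the left. Suppose $\pi(2)=1$. Let $i+1$ be the minimal non-excedance of $\pi$ greater than $2$ (if there is none, put $i=N+1$). Let $\sigma$ be the permutation of $\{1,3,4,\dots,N+1\}\cup\{i+\frac12\}$ obtained by collapsing $\pi$ at $2$ and adding a fixed point at $i+\frac12$. Transition $\pi\to\mathrm{Norm}(\sigma)$ with probability $\frac{\alpha}{N+1}$. (b) Particle hops right. For each $2\le i\le N$ with $\pi(i)\ge i$ and $\pi(i+1)<i+1$, a transition $\pi\to\mathrm{Norm}(\sigma)$ with probability $\frac1{N+1}$, where: Case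 1: if $\pi(i)=i$, let $j+1$ be the smallest non-excedance of $\pi$ with $j>i$ (if there is none, put $j=N+1$); $\sigma$ is obtained from $\pi$ by deleting the fixed point $i$ and inserting a new fixed point at $j+\frac12$. Case 2: if $\pi(i)>i$ and $\pi(i+1)<i$, then $\sigma(i)=\pi(i+1)$, $\sigma(i+1)=\pi(i)$, and $\sigma(k)=\pi(k)$ for $k\ne i,i+1$. Case 3: if $\pi(i)>i$ and $\pi(i+1)=i$, let $j$ be the greatest weak excedance of $\pi$ less than $i$ and $b=\pi^{-1}(j)$; $\sigma$ is the permutation of $(\{1,\dots,N+1\}\setminus\{i+1\})\cup\{j+\frac12\}$ obtained by collapsing $\pi$ at $i+1$ and then replacing $b\mapsto j$ by $\sigma(b)=j+\frac12$ and $\sigma(j+\frac12)=j$. (c) Particle exits to the right. If $\pi(N+1)=N+1$, let $i$ be the maximal weak excedance of $\pi$ less than $N+1$ and $a=\pi^{-1}(i)$. Let $\sigma$ be the permutation of $\{1,\dots,N\}\cup\{i+\frac12\}$ obtained by deleting the fixed point $N+1$ and replacing $\pi(a)=i$ by $\sigma(a)=i+\frac12$ and $\sigma(i+\frac12)=i$. Transition $\pi\to\mathrm{Norm}(\sigma)$ with probability $\frac{\beta}{N+1}$. (d) Particle hops left. For each $i\le N$ with $\pi(i)<i$ and $\pi(i+1)\ge i+1$, let $\sigma(i)=\pi(i+1)$, $\sigma(i+1)=\pi(i)$ and $\sigma(k)=\pi(k)$ for $k\neq i,i+1$. Transition $\pi\to\sigma$ with probability $\frac q{N+1}$. *)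

(* Defs.v *)
From HB Require Import structures.
From mathcomp Require Import all_boot all_order all_algebra all_fingroup.
From mathcomp Require Export mpoly.

Set Implicit Arguments.
Unset Strict Implicit.
Unset Printing Implicit Defensive.

Import Order.TTheory GRing.Theory Num.Theory.
Local Open Scope ring_scope.

(* S_(N+1) is 'S_N.+1, acting on 'I_N.+1 = {0, ..., N}. All the definitions
   below are written with the 1-based labels {1, ..., N+1}: [label pi k] is
   pi(k), and is meaningful for 1 <= k <= N+1 only. *)
Definition label N (pi : 'S_N.+1) (k : nat) : nat := (pi (inord k.-1)).+1.

Definition labels N : seq nat := iota 1 N.+1.

Definition wexc N (pi : 'S_N.+1) (k : nat) : bool := (k <= label pi k)%N.
Definition nexc N (pi : 'S_N.+1) (k : nat) : bool := (label pi k < k)%N.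

(* The default N+2 encodes the convention "if there is no such non-excedance
   i+1, put i = N+1". *)
Definition next_nexc N (pi : 'S_N.+1) (m : nat) : nat :=
  head N.+2 [seq k <- labels N | (m < k)%N && nexc pi k].

(* For 2 <= m <= N+1 the default is not used: 1 is always a weak excedance. *)
Definition prev_wexc N (pi : 'S_N.+1) (m : nat) : nat :=
  last 0%N [seq k <- labels N | (k < m)%N && wexc pi k].

(* A permutation of a finite set of (rational) numbers: its support, listed
   without repetition, and a function, of which only the restriction to the
   support matters. *)
Record fperm := FPerm { supp : seq rat; app :> rat -> rat }.

Definition fperm_of N (pi : 'S_N.+1) : fperm :=
  FPerm [seq k%:R | k <- labels N] (fun x => (label pi (Num.truncn x))%:R).

Definition del (f : fperm) (i : rat) : seq rat := [seq x <- supp f | x != i].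

Definition collapse (f : fperm) (i : rat) : fperm :=
  FPerm (del f i) (fun x => if f x == i then f i else f x).

Definition del_fix (f : fperm) (i : rat) : fperm := FPerm (del f i) f.

Definition add_fix (f : fperm) (x : rat) : fperm :=
  FPerm (x :: supp f) (fun y => if y == x then x else f y).

(* Replace b |-> j by b |-> x |-> j, where x is a new point. *)
Definition splice (f : fperm) (b x j : rat) : fperm :=
  FPerm (x :: supp f) (fun y => if y == x then j else if y == b then x else f y).

Definition swap_values (f : fperm) (i j : rat) : fperm :=
  FPerm (supp f) (fun x => if x == i then f j else if x == j then f i else f x).

(* [is_norm f tau]: tau = Norm(f). If supp f = {s_0 < ... < s_(n-1)}, this says
   f(s_k) = s_(tau k) for all k; in particular it forces f to permute supp f. *)
Definition is_norm (f : fperm) n (tau : 'S_n) : bool :=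
  let s := sort <=%R (supp f) in
  (size s == n) && [forall k : 'I_n, f (nth 0 s k) == nth 0 s (tau k)].

Definition plus_half (k : nat) : rat := k%:R + 2^-1.

Definition enters_left N (pi tau : 'S_N.+1) : bool :=
  let i := (next_nexc pi 2).-1 in
  (label pi 2 == 1%N) &&
  is_norm (add_fix (collapse (fperm_of pi) 2%:R) (plus_half i)) tau.

Definition hop_right_result N (pi : 'S_N.+1) (i : nat) : fperm :=
  let f := fperm_of pi in
  if label pi i == i then
    (* i+1 is itself a non-excedance, so j > i means j+1 > i+1. *)
    let j := (next_nexc pi i.+1).-1 in
    add_fix (del_fix f i%:R) (plus_half j)
  else if (label pi i.+1 < i)%N then
    swap_values f i%:R i.+1%:R
  else
    let j := prev_wexc pi i in
    let b := label (pi^-1)%g j in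
    splice (collapse f i.+1%:R) b%:R (plus_half j) j%:R.

Definition hops_right_at N (pi tau : 'S_N.+1) (i : nat) : bool :=
  [&& wexc pi i, nexc pi i.+1 & is_norm (hop_right_result pi i) tau].

Definition exits_right N (pi tau : 'S_N.+1) : bool :=
  let i := prev_wexc pi N.+1 in
  let a := label (pi^-1)%g i in
  (label pi N.+1 == N.+1) &&
  is_norm (splice (del_fix (fperm_of pi) N.+1%:R) a%:R (plus_half i) i%:R) tau.

(* Here the support stays {1, ..., N+1}, so that is_norm is just equality of
   permutations. *)
Definition hops_left_at N (pi tau : 'S_N.+1) (i : nat) : bool :=
  [&& nexc pi i, wexc pi i.+1
    & is_norm (swap_values (fperm_of pi) i%:R i.+1%:R) tau].

Definition PT_transition N (pi tau : 'S_N.+1) : Prop :=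
  [\/ enters_left pi tau,
      exists i : nat, (2 <= i <= N)%N /\ hops_right_at pi tau i,
      exits_right pi tau
    | exists i : nat, (1 <= i <= N)%N /\ hops_left_at pi tau i].

Definition PT_alpha : {mpoly rat[3]} := 'X_(@Ordinal 3 0 isT).
Definition PT_beta : {mpoly rat[3]} := 'X_(@Ordinal 3 1 isT).
Definition PT_q : {mpoly rat[3]} := 'X_(@Ordinal 3 2 isT).

(* w / (N+1) *)
Definition over_size (N : nat) (w : {mpoly rat[3]}) : {mpoly rat[3]} :=
  (N.+1%:R^-1 : rat) *: w.

(* Total probability of the moves leading from pi to tau. *)
Definition PT_move_prob N (pi tau : 'S_N.+1) : {mpoly rat[3]} :=
  (if enters_left pi tau then over_size N PT_alpha else 0)
  + \sum_(2 <= i < N.+1 | hops_right_at pi tau i) over_size N 1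
  + (if exits_right pi tau then over_size N PT_beta else 0)
  + \sum_(1 <= i < N.+1 | hops_left_at pi tau i) over_size N PT_q.

Definition PT_prob N (pi tau : 'S_N.+1) : {mpoly rat[3]} :=
  if pi == tau then 1 - \sum_(rho : 'S_N.+1 | rho != pi) PT_move_prob pi rho
  else PT_move_prob pi tau.

Definition bar_fun N (pi : 'S_N.+1) (i : 'I_N.+1) : 'I_N.+1 :=
  rev_ord (pi (if i == ord0 then ord0 else inord (N.+1 - i))).

Lemma bar_fun_inj N (pi : 'S_N.+1) : injective (bar_fun pi).
Proof.
have bnd (k : 'I_N.+1) : k != ord0 -> (0 < k)%N && (N.+1 - k < N.+1)%N.
  by rewrite -(inj_eq val_inj) /= -lt0n => k0; rewrite k0 ltn_subrL k0.
move=> i j /rev_ord_inj /perm_inj.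
have [->|/bnd/andP[i0 iN]] := eqVneq i ord0;
  have [->|/bnd/andP[j0 jN]] := eqVneq j ord0 => //.
- by move/(congr1 val); rewrite /= inordK // => /esym/eqP;
     rewrite subn_eq0 leqNgt ltn_ord.
- by move/(congr1 val); rewrite /= inordK // => /eqP;
     rewrite subn_eq0 leqNgt ltn_ord.
move/(congr1 val); rewrite /= !inordK // => e; apply: val_inj => /=.
by rewrite -(subKn (ltnW (ltn_ord i))) e subKn // ltnW.
Qed.

Definition bar N (pi : 'S_N.+1) : 'S_N.+1 := perm (@bar_fun_inj N pi).

(* The definition of bar, in 1-based labels. *)
Lemma label_bar1 N (pi : 'S_N.+1) :
  label (bar pi) 1 = (N.+2 - label pi 1)%N.
Proof.
rewrite /label permE /bar_fun /=.
have -> : inord 0 = ord0 :> 'I_N.+1 by apply: val_inj; rewrite /= inordK.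
by rewrite eqxx /= !subSS subSn // -ltnS ltn_ord.
Qed.

Lemma label_bar N (pi : 'S_N.+1) (i : nat) : (2 <= i <= N.+1)%N ->
  label (bar pi) i = (N.+2 - label pi (N + 3 - i))%N.
Proof.
case: i => [|[|i]] //= iN; rewrite /label permE /bar_fun /=.
rewrite -(inj_eq val_inj) /= inordK //=.
have -> : (N + 3 - i.+2).-1 = (N.+1 - i.+1)%N by rewrite addn3 !subSS subSn // ltnW.
by rewrite !subSS subSn // -ltnS ltn_ord.
Qed.

(* Main.v *)
Require Import Defs.
From mathcomp Require Import all_boot all_order all_algebra all_fingroup.
From mathcomp Require Import zify.

Set Implicit Arguments.
Unset Strict Implicit.
Unset Printing Implicit Defensive.

Import Order.TTheory GRing.Theory Num.Theory.

(** Every move of the chain, once normalized, has the same shape: the new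
permutation tau is given by tau (D k) = V (pi k), where D relabels positions
and V relabels values, each being a rotation of an interval of labels
([cyc p q]: p travels to q and the labels in between shift by one step
towards p) or a trivial relabelling. Deleting a point p and inserting one at
j + 1/2 moves p to the rank of j + 1/2 and shifts what lies between; that is
the rotation D. The rotation V is the same except that it also records the
collapse or the splitting of an arc. Thus, if j + 1/2 is the inserted point:

  - entering from the left:   D = cyc 2 j,          V = cyc 1 j;
  - exiting to the right:     D = cyc (N+1) (j+1),  V = cyc (N+1) j;
  - right hop, fixed point:   D = cyc i j,          V = cyc i j;
  - right hop, splitting:     D = cyc (i+1) (j+1),  V = cyc i j;
  - the two exchange hops:    D = cyc i (i+1),      V = id.

In these terms bar reverses positions (k goes to N+3-k, and 1 is fixed) and
values (v goes to N+2-v). Reversal conjugates [cyc p q] into the rotation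
between the reversed endpoints ([intertwines_cyc_bar]), so it exchanges
the first two lines, exchanges the third and the fourth, and preserves the
fifth. What remains is that the points j correspond. A position k >= 2 is a
weak excedance of pi exactly when N+3-k is a non-excedance of bar pi, so the
next non-excedance of pi is the reversal of the previous weak excedance of
bar pi ([next_nexc_bar]). The boundary cases agree too: the conventional
answer N+2, for want of a non-excedance, is the reversal of 1, which is always
a weak excedance.

Hence bar matches the moves one by one, and it exchanges the roles of alpha
and beta ([PT_move_prob_bar]). The statement about probabilities follows by
applying the automorphism of the polynomial ring that swaps these two
indeterminates, even if several moves lead from pi to sigma. *)

(** * Labels *)

Lemma mem_labels N k : (k \in labels N) = (1 <= k <= N.+1).
Proof. by rewrite mem_iota add1n ltnS. Qed.

Lemma label_in N (pi : 'S_N.+1) k : label pi k \in labels N.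
Proof. by rewrite mem_labels /label /= ltn_ord. Qed.

Lemma label_inj N (pi : 'S_N.+1) : {in labels N &, injective (label pi)}.
Proof.
move=> j k; rewrite !mem_labels => hj hk [] /val_inj /perm_inj /(congr1 val).
by rewrite /= !inordK; lia.
Qed.

Lemma label_invK N (pi : 'S_N.+1) j :
  j \in labels N -> label pi (label (pi^-1)%g j) = j.
Proof.
by rewrite mem_labels /label /= inord_val permKV => hj; rewrite inordK; lia.
Qed.

Lemma label_ext N (pi tau : 'S_N.+1) :
  {in labels N, label pi =1 label tau} -> pi = tau.
Proof.
move=> e; apply/permP => x; apply: val_inj.
have := e x.+1; rewrite mem_labels /label /= inord_val ltn_ord => /(_ isT).
by case.
Qed.

(** * Rotations of an interval of labels *)

Definition cyc (p q k : nat) : nat :=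
  if k == p then q
  else if p < k <= q then k.-1
  else if q <= k < p then k.+1 else k.

Lemma cycL p q : cyc p q p = q.
Proof. by rewrite /cyc eqxx. Qed.

(** A case distinction in a form that linear arithmetic can use. *)
Lemma cycP p q k :
  (k = p /\ cyc p q k = q) \/ (p < k <= q /\ cyc p q k = k.-1) \/
  (q <= k < p /\ cyc p q k = k.+1) \/
  (k <> p /\ ~~ (p < k <= q) /\ ~~ (q <= k < p) /\ cyc p q k = k).
Proof. by rewrite /cyc; repeat case: ifP => ?; lia. Qed.

Lemma cycK p q : cancel (cyc p q) (cyc q p).
Proof.
by move=> k; have := cycP p q k; have := cycP q p (cyc p q k); lia.
Qed.

Lemma cyc_labels N p q k : p \in labels N -> q \in labels N ->
  k \in labels N -> cyc p q k \in labels N.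
Proof. by rewrite !mem_labels; have := cycP p q k; lia. Qed.

Lemma perm_labels N (D : nat -> nat) :
  {in labels N, forall k, D k \in labels N} -> {in labels N &, injective D} ->
  perm_eq [seq D k | k <- labels N] (labels N).
Proof.
move=> DL Dinj.
have uD : uniq [seq D k | k <- labels N] by rewrite map_inj_in_uniq ?iota_uniq.
apply: uniq_perm => //; first exact: iota_uniq.
apply: (uniq_min_size uD _ _).2; last by rewrite size_map.
by move=> _ /mapP[k kL ->]; exact: DL.
Qed.

Lemma perm_labels_cyc N p q : p \in labels N -> q \in labels N ->
  perm_eq [seq cyc p q k | k <- labels N] (labels N).
Proof.
move=> pL qL; apply: perm_labels; first by move=> k; exact: cyc_labels.
by move=> x y _ _; exact: (can_inj (cycK p q)).
Qed.

(** * Normalization as an intertwining relation *)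

Definition intertwines N (pi tau : 'S_N.+1) (D V : nat -> nat) : bool :=
  all (fun k => label tau (D k) == V (label pi k)) (labels N).

(** Normalization can be read along any increasing enumeration g of the
support: since g is its own sorted order, no sorting is left to compute. *)
Lemma is_norm_enum N (f : fperm) (tau : 'S_N.+1) (g : nat -> rat) :
  {in labels N &, {mono g : j k / (j < k)%N >-> (j < k)%R}} ->
  perm_eq (supp f) [seq g k | k <- labels N] ->
  is_norm f tau = all (fun k => f (g k) == g (label tau k)) (labels N).
Proof.
move=> gmono fg; rewrite /is_norm.
have -> : sort <=%R (supp f) = [seq g k | k <- labels N].
  rewrite (elimT (perm_sort_leP _ _) fg) sorted_sort //; first exact: le_trans.
  rewrite sorted_map; have := iota_ltn_sorted 1 N.+1.
  apply: (sub_in_sorted (P := [in labels N])); last by apply/allP.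
  by move=> j k jL kL /= jk; rewrite ltW // gmono.
rewrite size_map size_iota eqxx andTb.
have gE (k : 'I_N.+1) : (nth 0 [seq g k | k <- labels N] k = g k.+1)%R.
  by rewrite (nth_map 0%N) ?size_iota // nth_iota.
apply/forallP/allP => [H k kL | H k].
  have := H (inord k.-1); rewrite !gE.
  by rewrite /= inordK ?prednK //; move: kL; rewrite mem_labels; lia.
rewrite !gE; have := H k.+1; rewrite /label /= inord_val; apply.
by rewrite mem_labels /= ltn_ord.
Qed.

(** The positions of the normalized permutation are visited in the order
D 1, D 2, ..., so that the label k of pi, rather than a rank in the support
of f, becomes the variable. *)
Lemma is_norm_intertwines N (f : fperm) (pi tau : 'S_N.+1) (g : nat -> rat)
    (D V : nat -> nat) :
  {in labels N &, {mono g : j k / (j < k)%N >-> (j < k)%R}} ->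
  perm_eq (supp f) [seq g k | k <- labels N] ->
  perm_eq [seq D k | k <- labels N] (labels N) ->
  {in labels N, forall v, V v \in labels N} ->
  {in labels N, forall k, f (g (D k)) = g (V (label pi k))} ->
  is_norm f tau = intertwines pi tau D V.
Proof.
move=> gmono fg DL VL fgE; rewrite (is_norm_enum _ gmono fg).
have ginj : {in labels N &, injective g}.
  move=> j k jL kL e; have := gmono _ _ jL kL; have := gmono _ _ kL jL.
  by rewrite e ltxx; lia.
rewrite -(perm_all _ DL) all_map; apply: eq_in_all => k kL /=.
by rewrite fgE // eq_sym (inj_in_eq ginj) ?label_in ?VL ?label_in.
Qed.

(** * Moving one point to a half-integer *)

Lemma plus_half_natF j k : (k%:R == plus_half j)%R = false.
Proof.
apply/negbTE/eqP => /(congr1 ( *%R 2))%R.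
rewrite /plus_half mulrDr divff // -!natrM -[1%R]/(1%:R)%R -natrD => /eqP.
by rewrite eqr_nat; lia.
Qed.

(** The increasing enumeration of the labels with p removed and j + 1/2
inserted, when q is the rank that j + 1/2 receives; the other ranks are
read off by undoing the rotation [cyc p q]. *)
Definition slot (j p q m : nat) : rat :=
  if m == q then plus_half j else ((cyc q p m)%:R)%R.

Lemma slot_new j p q : slot j p q q = plus_half j.
Proof. by rewrite /slot eqxx. Qed.

Lemma slot_old j p q k : k != p -> slot j p q (cyc p q k) = (k%:R)%R.
Proof.
move=> kp; rewrite /slot cycK ifN //.
by rewrite -{2}(cycL p q) (inj_eq (can_inj (cycK p q))).
Qed.

(** The rank of j + 1/2 is j if the removed point p is one of 1, ..., j, and
j + 1 otherwise. Monotonicity is an inequality between integers once the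
values are doubled. *)
Lemma slot_mono j p q : q = (if p <= j then j else j.+1) ->
  {mono slot j p q : m n / (m < n)%N >-> (m < n)%R}.
Proof.
move=> hq m n.
(* h is twice the value of slot j p q. *)
pose h m := if m == q then j.*2.+1 else (cyc q p m).*2.
have hE k : (slot j p q k * 2 = (h k)%:R)%R.
  rewrite /slot /h; case: eqP => _; last by rewrite -muln2 natrM.
  rewrite /plus_half mulrDl mulVf // -natrM -[1%R]/(1%:R)%R -natrD.
  by rewrite muln2 addn1.
rewrite -(ltr_pM2r (x := 2%R)) // !hE ltr_nat /h.
have := cycP q p m; have := cycP q p n.
by move: hq; do 3 case: ifP => ?; lia.
Qed.

Lemma perm_supp_slot N (pi : 'S_N.+1) j p q :
  p \in labels N -> q \in labels N ->
  perm_eq (plus_half j :: del (fperm_of pi) p%:R)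
    [seq slot j p q k | k <- labels N].
Proof.
move=> pL qL; rewrite perm_sym.
have := perm_labels_cyc pL qL; rewrite perm_sym => cycL'.
apply: perm_trans (perm_map _ cycL') _.
apply: perm_trans (perm_map _ (perm_map _ (perm_to_rem pL))) _.
rewrite !map_cons cycL slot_new perm_cons rem_filter ?iota_uniq // -map_comp.
rewrite /del -[supp _]/[seq (k%:R)%R | k <- labels N] filter_map.
rewrite (eq_filter (a1 := preim _ _) (a2 := predC1 p)); last first.
  by move=> k; rewrite /= eqr_nat.
set s := filter _ _.
suff -> : [seq (slot j p q \o cyc p q) k | k <- s] = [seq (k%:R)%R | k <- s].
  by [].
apply/eq_in_map => k.
by rewrite mem_filter => /andP[kp _]; rewrite /= slot_old.
Qed.

(** * The moves of the chain as pairs of rotations *)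

Lemma next_nexc_bounds N (pi : 'S_N.+1) m : m <= N.+1 ->
  m < next_nexc pi m <= N.+2.
Proof.
move=> mN; rewrite /next_nexc.
case E: filter => [|r s] /=; first by lia.
by have := mem_head r s; rewrite -E mem_filter mem_labels; lia.
Qed.

Lemma prev_wexc_bounds N (pi : 'S_N.+1) m : 1 < m -> 1 <= prev_wexc pi m < m.
Proof.
move=> m1; rewrite /prev_wexc.
set s := filter _ _; have s1 : 1 \in s by rewrite mem_filter mem_labels m1.
have : last 0 s \in s by case: s s1 => // x s' _; exact: mem_last.
by rewrite mem_filter mem_labels; lia.
Qed.

(** Common part of the moves that delete p and insert j + 1/2: such a move
only has to be evaluated at the new point, which takes over the role of p,
and at the surviving labels. *)
Lemma slot_norm N (f : fperm) (pi tau : 'S_N.+1) j p q (V : nat -> nat) :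
  q = (if p <= j then j else j.+1) -> p \in labels N -> q \in labels N ->
  supp f = plus_half j :: del (fperm_of pi) p%:R ->
  {in labels N, forall v, V v \in labels N} ->
  f (plus_half j) = slot j p q (V (label pi p)) ->
  {in labels N, forall k, k <> p ->
     f k%:R%R = slot j p q (V (label pi k))} ->
  is_norm f tau = intertwines pi tau (cyc p q) V.
Proof.
move=> hq pL qL fS VL fnew fold.
apply: (is_norm_intertwines tau (g := slot j p q)) => //.
- by move=> x y _ _; exact: slot_mono.
- by rewrite fS perm_supp_slot.
- exact: perm_labels_cyc.
move=> k kL; have [->|/eqP kp] := eqVneq k p; first by rewrite cycL slot_new.
by rewrite slot_old ?fold //; exact/eqP.
Qed.

Lemma slotE j p q m : m <> q -> slot j p q m = ((cyc q p m)%:R)%R.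
Proof. by rewrite /slot => /eqP/negbTE->. Qed.

(** The collapse at 2 sends the preimage of 2 to 1, so the value 2 becomes 1
and the value 1, attained at 2, becomes the new fixed point: this is why V
rotates from 1 while D rotates from 2. *)
Lemma enters_leftE N (pi tau : 'S_N.+1) : 1 <= N ->
  let i := (next_nexc pi 2).-1 in
  enters_left pi tau =
  (label pi 2 == 1) && intertwines pi tau (cyc 2 i) (cyc 1 i).
Proof.
move=> hN i; rewrite /enters_left -/i; case: eqP => //= pi2.
have hi : 2 <= i <= N.+1.
  by have := next_nexc_bounds pi (m := 2); rewrite /i; lia.
apply: (slot_norm tau (j := i)) => //.
- by case: ifP; lia.
- by rewrite mem_labels.
- by rewrite mem_labels; lia.
- by move=> v; apply: cyc_labels; rewrite mem_labels; lia.
- by rewrite /= eqxx pi2 cycL slot_new.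
move=> k kL k2; rewrite /= plus_half_natF !natrK eqr_nat pi2.
have vL := label_in pi k; have v1 : label pi k <> 1.
  rewrite -pi2 => /label_inj e; apply: k2; apply: e => //.
  by rewrite mem_labels.
move: vL; rewrite mem_labels => vL.
have := cycP 1 i (label pi k) => c1.
rewrite slotE; last by lia.
have := cycP i 2 (cyc 1 i (label pi k)) => c2.
by case: eqP => e; congr (_%:R)%R; lia.
Qed.

Lemma eq_label_inv N (pi : 'S_N.+1) k j : k \in labels N -> j \in labels N ->
  (k == label (pi^-1)%g j) = (label pi k == j).
Proof.
move=> kL jL; apply/eqP/eqP => [->|e]; first exact: label_invK.
by apply: (@label_inj _ pi); rewrite ?label_in // label_invK.
Qed.

(** Splitting the arc at i gives the value i to the new point, of rank i + 1,
and the value i + 1 to the preimage of i. So V already moves i, whereas D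
starts moving at i + 1. *)
Lemma exits_rightE N (pi tau : 'S_N.+1) : 1 <= N ->
  let i := prev_wexc pi N.+1 in
  exits_right pi tau =
  (label pi N.+1 == N.+1) && intertwines pi tau (cyc N.+1 i.+1) (cyc N.+1 i).
Proof.
move=> hN i; rewrite /exits_right -/i; case: eqP => //= piN.
have hi : 1 <= i < N.+1 by rewrite /i; apply: prev_wexc_bounds; lia.
have iL : i \in labels N by rewrite mem_labels; lia.
have NL : N.+1 \in labels N by rewrite mem_labels; lia.
apply: (slot_norm tau (j := i)) => //.
- by case: ifP; lia.
- by rewrite mem_labels; lia.
- by move=> v; apply: cyc_labels.
- rewrite /= eqxx piN cycL slotE; last by lia.
  by have := cycP i.+1 N.+1 i => c; congr (_%:R)%R; lia.
move=> k kL kN; rewrite /= plus_half_natF !natrK eqr_nat eq_label_inv //.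
have vL := label_in pi k; have vN : label pi k <> N.+1.
  by rewrite -piN => /label_inj e; apply: kN; exact: e.
move: vL; rewrite mem_labels => vL.
have := cycP N.+1 i (label pi k) => c1.
case: eqP => e.
  by rewrite (_ : cyc N.+1 i _ = i.+1) ?slot_new //; lia.
rewrite slotE; last by lia.
have := cycP i.+1 N.+1 (cyc N.+1 i (label pi k)) => c2.
by congr (_%:R)%R; lia.
Qed.

(** The support is unchanged, so the enumeration is that of the labels
themselves. *)
Lemma swap_valuesE N (pi tau : 'S_N.+1) i : 1 <= i <= N ->
  is_norm (swap_values (fperm_of pi) i%:R i.+1%:R) tau =
  intertwines pi tau (cyc i i.+1) id.
Proof.
move=> hi; apply: (is_norm_intertwines tau (g := fun k => (k%:R)%R)) => //.
- by move=> x y _ _; rewrite ltr_nat.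
- by apply: perm_labels_cyc; rewrite mem_labels; lia.
move=> k kL; rewrite /= !eqr_nat !natrK.
have := cycP i i.+1 k => c.
by case: eqP => e1; [|case: eqP => e2]; congr ((label _ _)%:R)%R; lia.
Qed.

Lemma hop_fixedE N (pi tau : 'S_N.+1) i : 2 <= i <= N -> label pi i = i ->
  let j := (next_nexc pi i.+1).-1 in
  is_norm (hop_right_result pi i) tau = intertwines pi tau (cyc i j) (cyc i j).
Proof.
move=> hi pii j; rewrite /hop_right_result pii eqxx -/j.
have hj : i < j <= N.+1.
  by have := next_nexc_bounds pi (m := i.+1); rewrite /j; lia.
apply: (slot_norm tau (j := j)) => //.
- by case: ifP; lia.
- by rewrite mem_labels; lia.
- by rewrite mem_labels; lia.
- by move=> v; apply: cyc_labels; rewrite mem_labels; lia.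
- by rewrite /= eqxx pii cycL slot_new.
move=> k kL ki; rewrite /= plus_half_natF !natrK slot_old //.
apply/eqP => e; apply: ki; apply: (@label_inj _ pi) => //; last by rewrite e.
by rewrite mem_labels; lia.
Qed.

(** The deleted point i + 1, with value i, gives way to the new point, whose
image is j: so V sends i to j. The collapse at i + 1 gives the value i to the
preimage of i + 1, and the rank of i is now i + 1: this value is unchanged,
which is why V stops at i although D reaches i + 1. *)
Lemma hop_splitE N (pi tau : 'S_N.+1) i : 2 <= i <= N ->
  label pi i <> i -> label pi i.+1 = i ->
  let j := prev_wexc pi i in
  is_norm (hop_right_result pi i) tau =
  intertwines pi tau (cyc i.+1 j.+1) (cyc i j).
Proof.
move=> hi pii pii1 j; rewrite /hop_right_result -/j.
move/eqP/negbTE: pii => ->; rewrite pii1 ltnn.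
have hj : 1 <= j < i by rewrite /j; apply: prev_wexc_bounds; lia.
have iL : i \in labels N by rewrite mem_labels; lia.
have jL : j \in labels N by rewrite mem_labels; lia.
apply: (slot_norm tau (j := j)) => //.
- by case: ifP; lia.
- by rewrite mem_labels; lia.
- by rewrite mem_labels; lia.
- by move=> v; apply: cyc_labels.
- rewrite /= eqxx pii1 cycL slotE; last by lia.
  by have := cycP j.+1 i.+1 j => c; congr (_%:R)%R; lia.
move=> k kL ki; rewrite /= plus_half_natF !natrK !eqr_nat eq_label_inv //.
have vL := label_in pi k; have vN : label pi k <> i.
  rewrite -pii1 => /label_inj e; apply: ki; apply: e => //.
  by rewrite mem_labels; lia.
move: vL; rewrite mem_labels => vL; rewrite pii1.
have := cycP i j (label pi k) => c1.
case: eqP => e.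
  by rewrite (_ : cyc i j _ = j.+1) ?slot_new //; lia.
rewrite slotE; last by lia.
have := cycP j.+1 i.+1 (cyc i j (label pi k)) => c2.
by case: eqP => e'; congr (_%:R)%R; lia.
Qed.

(** * Reversal of positions and values *)

Definition pos_rev N k := if k == 1 then 1 else N + 3 - k.
Definition val_rev N v := N.+2 - v.

Lemma pos_rev_labels N k : k \in labels N -> pos_rev N k \in labels N.
Proof. by rewrite !mem_labels /pos_rev; case: eqP; lia. Qed.

Lemma pos_revK N : {in labels N, involutive (pos_rev N)}.
Proof. by move=> k; rewrite mem_labels /pos_rev; repeat case: eqP; lia. Qed.

Lemma label_bar_rev N (pi : 'S_N.+1) k : k \in labels N ->
  label (bar pi) (pos_rev N k) = val_rev N (label pi k).
Proof.
rewrite mem_labels /pos_rev /val_rev => kL; case: eqP => [->|k1].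
  exact: label_bar1.
by rewrite label_bar; [congr (_ - label _ _)|]; lia.
Qed.

Lemma barK N : involutive (@bar N).
Proof.
move=> pi; apply: label_ext => k kL.
rewrite -[k in label _ k](pos_revK kL) !label_bar_rev ?pos_rev_labels //.
by have := label_in pi k; rewrite mem_labels /val_rev; lia.
Qed.

Lemma intertwines_bar N (pi tau : 'S_N.+1) D V D' V' :
  {in labels N, forall k, D k \in labels N} ->
  {in labels N, forall v, V v \in labels N} ->
  {in labels N, forall k, D' (pos_rev N k) = pos_rev N (D k)} ->
  {in labels N, forall v, V' (val_rev N v) = val_rev N (V v)} ->
  intertwines pi tau D V = intertwines (bar pi) (bar tau) D' V'.
Proof.
move=> DL VL DD VV; rewrite /intertwines.
have Pperm : perm_eq [seq pos_rev N k | k <- labels N] (labels N).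
  apply: perm_labels; first by move=> k; exact: pos_rev_labels.
  by move=> j k jL kL e; rewrite -(pos_revK jL) e pos_revK.
rewrite -[RHS](perm_all _ Pperm) all_map; apply: eq_in_all => k kL /=.
rewrite DD // !label_bar_rev ?DL // VV ?label_in //.
have := label_in tau (D k); have := VL _ (label_in pi k).
by rewrite !mem_labels /val_rev; lia.
Qed.

(** The position 1 is fixed by the reversal and lies outside the rotated
interval, hence the lower bounds on p and q. *)
Lemma cyc_pos_rev N p q k : 2 <= p <= N.+1 -> 2 <= q <= N.+1 ->
  k \in labels N ->
  cyc (N + 3 - p) (N + 3 - q) (pos_rev N k) = pos_rev N (cyc p q k).
Proof.
move=> hp hq; rewrite mem_labels => hk.
have := cycP p q k; have := cycP (N + 3 - p) (N + 3 - q) (pos_rev N k).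
by rewrite /pos_rev; case: eqP; case: eqP; lia.
Qed.

Lemma cyc_val_rev N p q v : p \in labels N -> q \in labels N ->
  v \in labels N ->
  cyc (val_rev N p) (val_rev N q) (val_rev N v) = val_rev N (cyc p q v).
Proof.
rewrite !mem_labels => hp hq hv.
have := cycP p q v; have := cycP (val_rev N p) (val_rev N q) (val_rev N v).
by rewrite /val_rev; lia.
Qed.

Lemma intertwines_cyc_bar N (pi tau : 'S_N.+1) p q r s :
  2 <= p <= N.+1 -> 2 <= q <= N.+1 -> r \in labels N -> s \in labels N ->
  intertwines pi tau (cyc p q) (cyc r s) =
  intertwines (bar pi) (bar tau) (cyc (N + 3 - p) (N + 3 - q))
    (cyc (N.+2 - r) (N.+2 - s)).
Proof.
move=> hp hq rL sL; apply: intertwines_bar => k kL.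
- by apply: cyc_labels => //; rewrite mem_labels; lia.
- exact: cyc_labels.
- exact: cyc_pos_rev.
- exact: cyc_val_rev.
Qed.

Lemma nexc_bar N (pi : 'S_N.+1) k : 2 <= k <= N.+1 ->
  nexc (bar pi) (N + 3 - k) = wexc pi k.
Proof.
move=> hk; have := label_in pi k; rewrite mem_labels /nexc /wexc => vL.
by rewrite label_bar; [rewrite subKn|]; lia.
Qed.

Lemma wexc_bar N (pi : 'S_N.+1) k : 2 <= k <= N.+1 ->
  wexc (bar pi) (N + 3 - k) = nexc pi k.
Proof.
by move=> hk; rewrite -{2}(barK pi) -nexc_bar ?subKn ?barK; lia.
Qed.

(** * Correspondence of the moves *)

(** Reversal exchanges weak excedances and non-excedances from position 2 on,
and reverses the order. The default N + 2 on the left corresponds to the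
weak excedance 1 on the right. *)
Lemma next_nexc_bar N (pi : 'S_N.+1) m : 1 <= m <= N.+1 ->
  next_nexc pi m = N + 3 - prev_wexc (bar pi) (N + 3 - m).
Proof.
move=> hm; rewrite /next_nexc /prev_wexc -[labels N]/(1 :: iota 2 N).
have revI : iota 2 N = rev [seq N + 3 - k | k <- iota 2 N].
  apply: (@eq_from_nth _ 0); first by rewrite size_rev size_map.
  move=> k; rewrite size_iota => kN.
  rewrite nth_rev size_map size_iota // (nth_map 0) ?size_iota; last by lia.
  by rewrite !nth_iota; lia.
rewrite [X in _ - last _ (filter _ (_ :: X))]revI /= filter_rev filter_map.
(* The label 1 is excluded on the left; on the right it heads the list. *)
rewrite ifF; last by lia.
rewrite ifT; last by have := label_in (bar pi) 1; rewrite mem_labels /wexc; lia.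
set P := preim _ _.
have -> : filter P (iota 2 N) = [seq k <- iota 2 N | (m < k) && nexc pi k].
  apply: eq_in_filter => k; rewrite mem_iota /P /= => hk.
  by rewrite wexc_bar; lia.
case E: filter => [|r s] /=; first by rewrite addn3 subn1.
rewrite rev_cons last_rcons.
have := mem_head r s; rewrite -E mem_filter mem_iota; lia.
Qed.

Lemma enters_left_bar N (pi tau : 'S_N.+1) : 1 <= N ->
  enters_left pi tau = exits_right (bar pi) (bar tau).
Proof.
move=> hN; rewrite enters_leftE // exits_rightE // label_bar; last by lia.
rewrite (_ : N + 3 - N.+1 = 2); last by lia.
have := label_in pi 2; rewrite mem_labels => h2.
rewrite (_ : (N.+2 - _ == N.+1) = (label pi 2 == 1)); last by lia.
rewrite next_nexc_bar; last by lia.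
rewrite (_ : N + 3 - 2 = N.+1); last by lia.
have := prev_wexc_bounds (bar pi) (m := N.+1).
set i := prev_wexc _ _ => hi; rewrite intertwines_cyc_bar ?mem_labels; try lia.
rewrite (_ : N + 3 - 2 = N.+1); last by lia.
rewrite (_ : N.+2 - 1 = N.+1); last by lia.
rewrite (_ : N + 3 - (N + 3 - i).-1 = i.+1); last by lia.
by rewrite (_ : N.+2 - (N + 3 - i).-1 = i); last by lia.
Qed.

(** A fixed point i of pi becomes a position N+3-i of bar pi with value
N+2-i, that is, a hop at N+2-i that splits an arc. *)
Lemma hop_fixed_bar N (pi tau : 'S_N.+1) i : 2 <= i <= N -> label pi i = i ->
  is_norm (hop_right_result pi i) tau =
  is_norm (hop_right_result (bar pi) (N.+2 - i)) (bar tau).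
Proof.
move=> hi pii; rewrite hop_fixedE // hop_splitE; first last.
- rewrite label_bar; last by lia.
  by rewrite (_ : N + 3 - (N.+2 - i).+1 = i) ?pii; lia.
- rewrite label_bar; last by lia.
  rewrite (_ : N + 3 - (N.+2 - i) = i.+1); last by lia.
  have := @label_inj _ pi i i.+1; have := label_in pi i.+1.
  by rewrite !mem_labels pii; lia.
- lia.
rewrite next_nexc_bar; last by lia.
rewrite (_ : N + 3 - i.+1 = N.+2 - i); last by lia.
have := prev_wexc_bounds (bar pi) (m := N.+2 - i).
set j := prev_wexc _ _ => hj; rewrite intertwines_cyc_bar ?mem_labels; try lia.
rewrite (_ : N + 3 - i = (N.+2 - i).+1); last by lia.
rewrite (_ : N + 3 - (N + 3 - j).-1 = j.+1); last by lia.
by rewrite (_ : N.+2 - (N + 3 - j).-1 = j); last by lia.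
Qed.

Lemma swap_values_bar N (pi tau : 'S_N.+1) i : 2 <= i <= N ->
  is_norm (swap_values (fperm_of pi) i%:R i.+1%:R) tau =
  is_norm (swap_values (fperm_of (bar pi)) (N.+2 - i)%:R (N.+2 - i).+1%:R)
    (bar tau).
Proof.
move=> hi; rewrite !swap_valuesE; try lia.
apply: intertwines_bar => // k kL.
  by apply: cyc_labels; rewrite // mem_labels; lia.
rewrite -cyc_pos_rev //; try lia.
have := cycP (N + 3 - i) (N + 3 - i.+1) (pos_rev N k).
by have := cycP (N.+2 - i) (N.+2 - i).+1 (pos_rev N k); lia.
Qed.

Lemma hops_right_bar N (pi tau : 'S_N.+1) i : 2 <= i <= N ->
  hops_right_at pi tau i = hops_right_at (bar pi) (bar tau) (N.+2 - i).
Proof.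
move=> hi; rewrite /hops_right_at.
have e1 : N.+2 - i = N + 3 - i.+1 by lia.
have e2 : (N.+2 - i).+1 = N + 3 - i by lia.
rewrite e2 {1}e1 wexc_bar ?nexc_bar; try lia.
rewrite andbCA; case w : (wexc pi i) => //=; case n : (nexc pi i.+1) => //=.
have b1 : label (bar pi) (N.+2 - i) = N.+2 - label pi i.+1.
  by rewrite label_bar; [congr (_ - label _ _)|]; lia.
have b2 : label (bar pi) (N.+2 - i).+1 = N.+2 - label pi i.
  by rewrite label_bar; [congr (_ - label _ _)|]; lia.
have := label_in pi i; have := label_in pi i.+1.
move: w n; rewrite !mem_labels /wexc /nexc => w n h1 h2.
have [pii|/eqP pii] := eqVneq (label pi i) i; first exact: hop_fixed_bar.
have [pi1|/eqP pi1] := eqVneq (label pi i.+1) i.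
  (* The splitting hop is the mirror image of a fixed-point hop of bar pi. *)
  have := @hop_fixed_bar N (bar pi) (bar tau) (N.+2 - i).
  rewrite !barK (_ : N.+2 - (N.+2 - i) = i); last by lia.
  by move=> -> //; [lia | rewrite b1 pi1].
rewrite /hop_right_result b1 b2.
rewrite (_ : (label pi i == i) = false); last by lia.
rewrite (_ : (label pi i.+1 < i) = true); last by lia.
rewrite (_ : (_ - label pi i.+1 == _) = false); last by lia.
rewrite (_ : (_ - label pi i < _) = true); last by lia.
exact: swap_values_bar.
Qed.

Lemma hops_left_bar N (pi tau : 'S_N.+1) i : 2 <= i <= N ->
  hops_left_at pi tau i = hops_left_at (bar pi) (bar tau) (N.+2 - i).
Proof.
move=> hi; rewrite /hops_left_at -swap_values_bar //.
have e1 : N.+2 - i = N + 3 - i.+1 by lia.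
have e2 : (N.+2 - i).+1 = N + 3 - i by lia.
by rewrite e2 e1 wexc_bar ?nexc_bar 1?andbCA; lia.
Qed.

Lemma hops_left_at1 N (pi tau : 'S_N.+1) : hops_left_at pi tau 1 = false.
Proof.
by apply/negbTE; rewrite /hops_left_at /nexc; have := label_in pi 1;
   rewrite mem_labels; lia.
Qed.

Lemma PT_transition_bar N (pi tau : 'S_N.+1) : 1 <= N ->
  PT_transition pi tau -> PT_transition (bar pi) (bar tau).
Proof.
move=> hN [e|[i [hi h]]|e|[i [hi h]]].
- by apply: Or43; rewrite -enters_left_bar.
- apply: Or42; exists (N.+2 - i); rewrite -hops_right_bar //.
  by split=> //; lia.
- by apply: Or41; rewrite enters_left_bar // !barK.
have {}hi : 2 <= i <= N.
  by case: i hi h => [|[|i]] //; rewrite hops_left_at1.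
by apply: Or44; exists (N.+2 - i); rewrite -hops_left_bar //; split=> //; lia.
Qed.

(** * Probabilities *)

Definition swap_rates : {mpoly rat[3]} -> {mpoly rat[3]} :=
  msym (tperm (@Ordinal 3 0 isT) (@Ordinal 3 1 isT)).

Lemma swap_rates_over N w :
  swap_rates (over_size N w) = over_size N (swap_rates w).
Proof. exact: msymZ. Qed.

Lemma msymX1 n (R : nzRingType) (s : 'S_n) (i : 'I_n) :
  msym s ('X_i : {mpoly R[n]}) = 'X_(s i).
Proof.
rewrite msymX; congr 'X_[_]; apply/mnmP => j.
by rewrite !mnmE -(inj_eq (@perm_inj _ s)) permKV.
Qed.

Lemma swap_rates_alpha : swap_rates PT_alpha = PT_beta.
Proof. by rewrite /swap_rates /PT_alpha msymX1 tpermL. Qed.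

Lemma swap_rates_beta : swap_rates PT_beta = PT_alpha.
Proof. by rewrite /swap_rates /PT_beta msymX1 tpermR. Qed.

Lemma swap_rates_q : swap_rates PT_q = PT_q.
Proof. by rewrite /swap_rates /PT_q msymX1 tpermD. Qed.

Lemma swap_rates1 : swap_rates 1%R = 1%R.
Proof. exact: rmorph1. Qed.

Lemma sum_const_rev (V : nmodType) N (P Q : pred nat) (c : V) :
  (forall i, 2 <= i <= N -> P i = Q (N.+2 - i)) ->
  (\sum_(2 <= i < N.+1 | P i) c = \sum_(2 <= i < N.+1 | Q i) c)%R.
Proof.
move=> PQ; rewrite [RHS]big_nat_rev.
rewrite [LHS]big_nat_cond [RHS]big_nat_cond; apply: eq_bigl => i.
by case: (boolP (2 <= i < N.+1)) => //= hi; rewrite PQ.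
Qed.

(** The left hops at i = 1 have no mirror image among the indices up to N, but
they never occur: 1 is not a non-excedance. *)
Lemma PT_move_prob_bar N (pi tau : 'S_N.+1) : 1 <= N ->
  PT_move_prob (bar pi) (bar tau) = swap_rates (PT_move_prob pi tau).
Proof.
move=> hN; have sD : {morph swap_rates : x y / (x + y)%R} by exact: raddfD.
have s0 : swap_rates 0%R = 0%R by exact: raddf0.
have s_sum m n (P : pred nat) w : swap_rates (\sum_(m <= i < n | P i) w)%R
  = (\sum_(m <= i < n | P i) swap_rates w)%R by exact: raddf_sum.
rewrite /PT_move_prob -enters_left_bar //.
rewrite [enters_left (bar pi) _]enters_left_bar // !barK.
rewrite !(big_ltn_cond _ (m := 1)) ?ltnS // !hops_left_at1.
rewrite !sD !s_sum 2!(fun_if swap_rates) s0 !swap_rates_over.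
rewrite swap_rates_alpha swap_rates_beta swap_rates_q swap_rates1.
rewrite -(sum_const_rev _ (fun i => @hops_right_bar N pi tau i)).
rewrite -(sum_const_rev _ (fun i => @hops_left_bar N pi tau i)).
by congr (_ + _)%R; rewrite addrAC [RHS]addrC addrA.
Qed.

Theorem theorem7p4 (N : nat) (hN : (1 <= N)%N) (pi sigma : 'S_N.+1)
    (hne : pi <> sigma) :
  (PT_transition pi sigma <-> PT_transition (bar pi) (bar sigma)) /\
  (PT_prob pi sigma = over_size N PT_alpha <->
     PT_prob (bar pi) (bar sigma) = over_size N PT_beta) /\
  (PT_prob pi sigma = over_size N PT_beta <->
     PT_prob (bar pi) (bar sigma) = over_size N PT_alpha) /\
  (PT_prob pi sigma = over_size N 1%R <->
     PT_prob (bar pi) (bar sigma) = over_size N 1%R) /\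
  (PT_prob pi sigma = over_size N PT_q <->
     PT_prob (bar pi) (bar sigma) = over_size N PT_q).
Proof.
have swapE v w : swap_rates v = w ->
    PT_prob pi sigma = over_size N v <->
    PT_prob (bar pi) (bar sigma) = over_size N w.
  move=> <-; rewrite /PT_prob (inj_eq (can_inj (@barK N))).
  rewrite (introF eqP hne) PT_move_prob_bar // -swap_rates_over.
  by split=> [-> | /inj_msym].
split.
  split; first exact: PT_transition_bar.
  by move/(PT_transition_bar hN); rewrite !barK.
split; first exact: swapE swap_rates_alpha.
split; first exact: swapE swap_rates_beta.
split; first exact: swapE swap_rates1.
exact: swapE swap_rates_q.
Qed.
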